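(* Let $C_j=\{y_1,y_2,\dots,y_k\}$ be a level-$j$ chain, where $j\ge1$ is an integer. Let $t$ be a size-stable time. Let $y_0(t)=l(y_1(t))$ and $y_{k+1}(t)=r(y_k(t))$. There exist real numbers $y_0'$ and $y_{k+1}'$ such that $y_0(t)\rightarrow y_0'$ and $y_{k+1}(t)\rightarrow y_{k+1}'$ as $t\rightarrow\infty$. Moreover, for all $0\le i\le k+1$, $$y_i(t)\rightarrow y_0'+\frac{|y_{k+1}'-y_0'|}{k+1}\,i$$ as $t\rightarrow\infty$.
   Context: Model. $X=\{x_0,x_1,\dots,x_n\}$ is a finite set of robots on the real line; $x(t)$ is the position of robot $x$ at the discrete time $t=0,1,2,\dots$, and $X(t)=\{x_0(t),\dots,x_n(t)\}$ (the same symbol may denote a robot and its position). Initial positions are arbitrary, and robots need not occupy distinct positions. Exactly two robots are faulty and never move: $x_0$ is the leftmost faulty robot and $x_n$ the rightmost faulty robot, with $x_0(t)=0$ and $x_n(t)$ equal to a fixed positive number for all $t\ge0$. $V>0$ is the visibility radius. $N(x(t))$ is the set of robots $y$ with $|x(t)-y(t)|\le V$ (so $x$ itself belongs to it); $l(x(t))$ and $r(x(t))$ denote the leftmost and the rightmost robot in $N(x(t))$. All robots act synchronously: every non-faulty robot $x$ satisfies $x(t+1)=\frac{l(x(t))+r(x(t))}{2}$ for all $t\ge 0$. Non-faulty robots that end up in the same position merge: they behave identically and are considered as a single robot from then on. Size-stable time. A time $t_0$ is size-stable if, for all $t\ge t_0$: (i) there will be no inclusions (a robot entering the visibility range of a robot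 that did not see it before), mergings (robots coming to occupy the same position) or crossings (two robots exchanging their order on the line) in the system; and (ii) either all robots are inside the line segment $[x_0,x_n]$, or at most one robot is on each side of $[x_0,x_n]$ and stays outside of $[x_0,x_n]$; moreover, the two outsiders (those that exist) converge to $x_0$ and $x_n$, respectively. It is assumed that the earliest size-stable time is $0$, so that every $t\ge 0$ is size-stable. Chains. Let $m$ be an integer with $0\le m\le n$. A mutual chain at a size-stable time $t$ is a configuration $\{z_1(t),\dots,z_m(t)\}\subset X(t)$ of $m$ robots such that $l(z_{i+1}(t))=z_i(t)$ and $r(z_i(t))=z_{i+1}(t)$ for all $1\le i\le m-1$. Its left and right anchors are $l(z_1(t))$ and $r(z_m(t))$, and it is said to be anchored at these; anchors may belong to the chain, and a chain may consist of a single robot. Levels. The primary chain $\mathcal{C}_1=\{x_0',x_1',\dots,x_k'\}\subseteq X$ is the unique mutual chain anchored at $x_0$ and $x_n$ with $x_0'=x_0$ and $x_k'=x_n$; it is called a level-$1$ chain. A secondary chain is a mutual chain anchored at two robots $x,x'\in\mathcal{C}_1$ at least one of which is non-faulty; it is called a level-$2$ chain. For $j>2$, a configuration of robots is a level-$j$ chain if it is a mutual chain anchored at two robots $x$ and $x'$ for which there exists an index $j'<j$ such that either $x$ is part of a level-$j'$ chain and $x'$ is part of a level-$(j-1)$ chain, or $x$ is part of a level-$(j-1)$ chain and $x'$ is part of a level-$j'$ chain.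
   Formalization: y_1,...,y_k list only the members of C_j that are not its anchors (at least one): listing x_0 as y_1 makes y_0=y_1 motionless and the formula false. If a faulty and a non-faulty robot tie as leftmost or rightmost, l or r denotes the faulty one. *)

(* Defs.v *)
From HB Require Import structures.
From mathcomp Require Import all_boot all_order all_algebra.
From mathcomp Require Import all_classical all_reals all_analysis.

Set Implicit Arguments.
Unset Strict Implicit.
Unset Printing Implicit Defensive.
Import Order.TTheory GRing.Theory Num.Theory.
Import numFieldNormedType.Exports.
Local Open Scope classical_set_scope.
Local Open Scope ring_scope.

(* The robots x_0, ..., x_n are the elements of 'I_n.+1; indices carry no
   information on the order of the robots along the line. A trajectory
   p : nat -> 'I_n.+1 -> R gives the position p t x of robot x at time t. *)
Section Robots.
Context (R : realType) (n : nat).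
Local Notation robot := 'I_n.+1.
Implicit Types (p : nat -> robot -> R) (V : R) (t : nat).
Implicit Types (x y a b : robot) (z c : seq robot).

Definition x_first : robot := ord0.
Definition x_last : robot := ord_max.

Definition faulty : pred robot := pred2 x_first x_last.

Definition nbr p V t x : pred robot := [pred y | `|p t x - p t y| <= V].

(* Positions of l(x(t)) and r(x(t)). The default value p t x is harmless as
   x is in its own neighbourhood. *)
Definition lpos p V t x : R := \big[Num.min/p t x]_(y in nbr p V t x) p t y.
Definition rpos p V t x : R := \big[Num.max/p t x]_(y in nbr p V t x) p t y.

Definition robot_system p V : Prop :=
  [/\ 0 < V,
      forall t, p t x_first = 0,
      exists2 d : R, 0 < d & forall t, p t x_last = d
    & forall t x, ~~ faulty x ->
        p t.+1 x = (lpos p V t x + rpos p V t x) / 2].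

Definition inclusion p V t x y : Prop :=
  V < `|p t x - p t y| /\ `|p t.+1 x - p t.+1 y| <= V.
Definition merging p t x y : Prop :=
  p t x <> p t y /\ p t.+1 x = p t.+1 y.
Definition crossing p t x y : Prop :=
  p t x < p t y /\ p t.+1 y < p t.+1 x.

Definition inside p t x : Prop := p t x_first <= p t x <= p t x_last.

(* Non-faulty robots in the same position count as one robot, so at most one
   robot on a side means that the robots there all share one position. *)
Definition lone_outsiders p t : Prop :=
  [/\ forall x y, p t x < p t x_first -> p t y < p t x_first -> p t x = p t y,
      forall x y, p t x_last < p t x -> p t x_last < p t y -> p t x = p t y,
      forall x s, ~ inside p t x -> (t <= s)%N -> ~ inside p s x,
      forall x, p t x < p t x_first ->
        (fun s => p s x) @ \oo --> p t x_first
    & forall x, p t x_last < p t x ->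
        (fun s => p s x) @ \oo --> p t x_last].

Definition size_stable p V (t0 : nat) : Prop :=
  forall t, (t0 <= t)%N ->
    (forall x y, [/\ ~ inclusion p V t x y, ~ merging p t x y
                   & ~ crossing p t x y])
    /\ ((forall x, inside p t x) \/ lone_outsiders p t).

(* Identity of the robots l(x(t)) and r(x(t)): is_l p V t x a means
   a = l(x(t)). Merged non-faulty robots are one robot, hence every one of
   them qualifies. A faulty robot never merges; when it shares the extreme
   position with non-faulty robots, the extreme robot is the faulty one. *)
Definition represents p t a : bool :=
  faulty a || [forall f, faulty f ==> (p t f != p t a)].
Definition is_l p V t x a : bool :=
  [&& a \in nbr p V t x, p t a == lpos p V t x & represents p t a].
Definition is_r p V t x b : bool :=
  [&& b \in nbr p V t x, p t b == rpos p V t x & represents p t b].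

(* A chain is listed from left to right. Its robots are distinct as points of
   X(t), since merged robots are a single robot. *)
Definition mutual_chain p V t z : bool :=
  uniq [seq p t x | x <- z] &&
  sorted (fun x y => is_l p V t y x && is_r p V t x y) z.

Definition anchored p V t z a b : bool :=
  if z is z1 :: z' then is_l p V t z1 a && is_r p V t (last z1 z') b
  else false.

(* The list x_0', ..., x_k'. It is a mutual chain whose extremities x_0, x_n
   are its anchors; l(x_0) = x_0 is not demanded, because an outsider may be
   visible from x_0, and likewise for x_n. *)
Definition primary_chain p V t c : Prop :=
  mutual_chain p V t c /\
  exists z, c = x_first :: rcons z x_last.

(* level_chain p V t j z a b: at time t, z is a level-j chain with left
   anchor a and right anchor b. *)
Inductive level_chain p V t : nat -> seq robot -> robot -> robot -> Prop :=
| Level1 c :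
    primary_chain p V t c -> level_chain p V t 1 c x_first x_last
| Level2 c z a b :
    primary_chain p V t c -> a \in c -> b \in c ->
    ~~ faulty a || ~~ faulty b ->
    mutual_chain p V t z -> anchored p V t z a b ->
    level_chain p V t 2 z a b
| LevelS j j' c a1 b1 c' a2 b2 z a b :
    (2 < j)%N -> (j' < j)%N ->
    level_chain p V t j' c a1 b1 -> level_chain p V t j.-1 c' a2 b2 ->
    (a \in c) && (b \in c') || (a \in c') && (b \in c) ->
    mutual_chain p V t z -> anchored p V t z a b ->
    level_chain p V t j z a b.

(* Anchors may belong to their chain, as x_0 and x_n do for the primary one.
   In the enumeration y_1, ..., y_k of a chain, flanked by y_0 = l(y_1) and
   y_{k+1} = r(y_k), the anchors are y_0 and y_{k+1} and not among the
   y_1, ..., y_k: otherwise y_0 and y_1 would both denote the motionless x_0. *)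
Definition non_anchors z a b : seq robot :=
  [seq x <- z | (x != a) && (x != b)].

(* Position of y_i at time t, for 0 <= i <= k+1. *)
Definition chain_pos p V (k : nat) (y : nat -> robot) (i : nat) t : R :=
  if i == 0%N then lpos p V t (y 1%N)
  else if i == k.+1 then rpos p V t (y k)
  else p t (y i).

End Robots.

(* Main.v *)
(* From time t on, the neighbours of a robot of a chain keep their identity:
   visibility is never lost, and strict order and coincidence of positions are
   preserved, except that a non-faulty robot standing on a faulty one may leave
   it, necessarily towards the inside of [x_0, x_n]. Hence the robots of a chain
   obey y_i(s+1) = (y_{i-1}(s) + y_{i+1}(s)) / 2 for all s >= t, a discrete heat
   equation whose boundary values are the positions of the anchors. If these
   converge, the distance to the affine interpolation of their limits is
   contracted up to a vanishing error, hence tends to 0. The anchors are faulty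
   or belong to chains of lower level, so induction on the level concludes. *)

Require Import Defs.
From HB Require Import structures.
From mathcomp Require Import all_boot all_order all_algebra.
From mathcomp Require Import all_classical all_reals all_analysis.
From mathcomp Require Import lra zify.

Set Implicit Arguments.
Unset Strict Implicit.
Unset Printing Implicit Defensive.
Import Order.TTheory GRing.Theory Num.Theory.
Import numFieldNormedType.Exports.
Local Open Scope classical_set_scope.
Local Open Scope ring_scope.

(** * Discrete heat equation on the sites 0 to k+1 with convergent boundary values *)

(* Along the concave weight 1 + i(k+1-i), averaging the two neighbours of an
   interior site loses exactly 1, hence contracts by a factor [rho] < 1. *)
Section Averaging.
Context (R : realType) (k : nat).

Let weight (i : nat) : R := 1 + i%:R * (k.+1%:R - i%:R).
(** A bound on all weights: a loss of 1 is thus a loss of at least the fraction [top^-1] of the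
    weight, whence [rho]. *)
Let top : R := 1 + k.+1%:R ^+ 2.
Let rho : R := 1 - top^-1.

Let weight_ge1 i : (i <= k.+1)%N -> 1 <= weight i.
Proof. by move=> ik; rewrite lerDl mulr_ge0// subr_ge0 ler_nat. Qed.

Let weight_le i : (i <= k.+1)%N -> weight i <= top.
Proof.
rewrite /weight /top -(ler_nat R) => ik; have := ler0n R i.
move: (i%:R) (k.+1%:R) ik => u v uv u0.
have : 0 <= v * (v - u) by rewrite mulr_ge0 ?subr_ge0// (le_trans u0).
have := sqr_ge0 u; move: uv; nra.
Qed.

Let top_ge1 : 1 <= top.
Proof. by rewrite lerDl sqr_ge0. Qed.

Let top_gt0 : 0 < top := lt_le_trans ltr01 top_ge1.

Let rho_ge0 : 0 <= rho.
Proof. by rewrite subr_ge0 invf_le1. Qed.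

Let rho_lt1 : rho < 1.
Proof. by rewrite ltrBlDr ltrDl invr_gt0. Qed.

Let weight_average i : (i < k.+1)%N ->
  (weight i + weight i.+2) / 2 <= rho * weight i.+1.
Proof.
move=> ik; have w := weight_le ik.
have -> : (weight i + weight i.+2) / 2 = weight i.+1 - 1.
  rewrite /weight -(natr1 i.+1) -(natr1 i); lra.
rewrite mulrBl mul1r lerB// ler_pdivrMl// mulr1//.
Qed.

(** Once both boundary errors stay below [d], induction on time bounds the error at each site by a
    constant multiple of its weight; the part of the constant in excess of [d] decays
    geometrically. *)
Lemma averaging_cvg0 (e : nat -> nat -> R) (T : nat) :
  (forall i s, (i < k)%N -> (T <= s)%N ->
     e i.+1 s.+1 = (e i s + e i.+2 s) / 2) ->
  e 0%N @ \oo --> 0 -> e k.+1 @ \oo --> 0 ->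
  forall i, (i <= k.+1)%N -> e i @ \oo --> 0.
Proof.
move=> step e0 ek i ik; apply/cvgrPdist_le => eps eps0.
(* Chosen so that [(d + d) * top = eps]: one [d] for the boundary, one for the decayed excess. *)
have eps' : 0 < eps / (2 * top) by rewrite divr_gt0// mulr_gt0.
set d := eps / (2 * top) in eps'.
have [S [TS bdry]] : exists S, (T <= S)%N /\
    forall s, (S <= s)%N -> `|e 0%N s| <= d /\ `|e k.+1 s| <= d.
  have /cvgrPdist_le/(_ _ eps')[S0 _ h0] := e0.
  have /cvgrPdist_le/(_ _ eps')[S1 _ h1] := ek.
  exists (maxn T (maxn S0 S1)); split=> [|s]; first exact: leq_maxl.
  rewrite !geq_max => /and3P[_ s0 s1].
  by have := h0 s s0; have := h1 s s1; rewrite /= !sub0r !normrN.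
(* [B] dominates all errors at time [S]; as weights are at least 1, this starts the induction. *)
pose B := \sum_(j < k.+2) `|e j S|.
have B0 : 0 <= B by apply: sumr_ge0 => j _; exact: normr_ge0.
have bound m : forall j, (j <= k.+1)%N ->
    `|e j (m + S)%N| <= (d + B * rho ^+ m) * weight j.
  elim: m => [|m IH] j jk.
    have w1 := weight_ge1 jk.
    apply: (@le_trans _ _ (B * 1)); last first.
      by apply: ler_pM => //; rewrite expr0 mulr1 lerDr ltW.
    rewrite mulr1 /B (bigD1 (Ordinal (jk : (j < k.+2)%N)))//= lerDl.
    by apply: sumr_ge0 => l _; exact: normr_ge0.
  have c0 q : 0 <= B * rho ^+ q by rewrite mulr_ge0// exprn_ge0.
  (* This settles the two boundary sites, where no averaging takes place. *)
  have sideline : d <= (d + B * rho ^+ m.+1) * weight j.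
    rewrite -[leLHS]mulr1; apply: ler_pM => //; first exact: ltW.
      by rewrite lerDl.
    exact: weight_ge1.
  case: j jk sideline => [|j] jk sideline.
    by apply: le_trans sideline; apply: (bdry _ _).1; exact: leq_addl.
  have [jk'|] := ltnP j k; last first.
    move=> kj; have {}jk : j = k by apply/eqP; rewrite eqn_leq kj andbT.
    rewrite jk in sideline *.
    by apply: le_trans sideline; apply: (bdry _ _).2; exact: leq_addl.
  rewrite addSn step//; last exact: leq_trans TS (leq_addl _ _).
  have h1 := IH j (leq_trans (leqnSn _) jk).
  have h2 := IH j.+2 jk'.
  set c := d + B * rho ^+ m in h1 h2.
  have cpos : 0 <= c by rewrite addr_ge0// ltW.
  apply: (@le_trans _ _ (c * ((weight j + weight j.+2) / 2))).
    rewrite normrM (ger0_norm (_ : 0 <= 2^-1))// mulrA ler_pM2r//.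
    by rewrite (le_trans (ler_normD _ _))// mulrDr lerD.
  apply: (@le_trans _ _ (c * (rho * weight j.+1))).
    by rewrite ler_wpM2l// weight_average.
  rewrite mulrA ler_wpM2r//; first exact: le_trans ler01 (weight_ge1 jk).
  (* Only the excess over [d] has to contract; for [d] itself, [d * rho <= d] is enough. *)
  rewrite /c mulrDl -(mulrA B) -exprSr lerD2r.
  by rewrite ler_piMr// ltW.
have rho0 : B * rho ^+ m @[m --> \oo] --> 0.
  rewrite -[X in _ --> X](mulr0 B); apply: cvgMr; apply: cvg_expr.
  by rewrite ger0_norm.
have /cvgrPdist_le/(_ _ eps')[M _ hM] := rho0.
exists (M + S)%N => // s /= Ms; rewrite sub0r normrN.
have -> : s = ((s - S) + S)%N by lia.
apply: le_trans (bound _ _ ik) _.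
have /hM/= : (M <= s - S)%N by lia.
rewrite sub0r normrN => hB.
have {}hB := le_trans (ler_norm _) hB.
apply: (@le_trans _ _ ((d + d) * top)); last first.
  by rewrite -mulr2n -mulr_natl mulrAC /d mulrC divfK// gt_eqF// mulr_gt0.
apply: ler_pM; [|exact: le_trans ler01 (weight_ge1 ik)| |exact: weight_le].
  2: by rewrite lerD2l.
by apply: addr_ge0; [exact: ltW|rewrite mulr_ge0// exprn_ge0].
Qed.

(** Affine functions of the site are fixed by averaging, so subtracting the interpolation [L] of the
    two limits leaves vanishing boundary values. *)
Lemma averaging_cvg (u : nat -> nat -> R) (T : nat) (la lb : R) :
  (forall i s, (i < k)%N -> (T <= s)%N ->
     u i.+1 s.+1 = (u i s + u i.+2 s) / 2) ->
  u 0%N @ \oo --> la -> u k.+1 @ \oo --> lb ->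
  forall i, (i <= k.+1)%N ->
    u i @ \oo --> la + (lb - la) / k.+1%:R * i%:R.
Proof.
move=> step u0 uk i ik.
pose L (j : nat) : R := la + (lb - la) / k.+1%:R * j%:R.
have Lk : L k.+1 = lb by rewrite /L divfK ?pnatr_eq0// addrC subrK.
apply/subr_cvg0; apply: (@averaging_cvg0 (fun j s => u j s - L j) T) => //.
- move=> j s jk Ts; rewrite step// /L; move: ((lb - la) / _) => c.
  rewrite -(natr1 j.+1) -(natr1 j); lra.
- by apply/subr_cvg0; rewrite /L mulr0 addr0.
- by apply/subr_cvg0; rewrite Lk.
Qed.

End Averaging.

(** * Bounds on neighbourhoods and their extreme positions *)

Section Neighbours.
Context (R : realType) (n : nat) (p : nat -> 'I_n.+1 -> R) (V : R).
Implicit Types (t : nat) (x y a : 'I_n.+1).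

Lemma nbrP t x y : reflect (- V <= p t x - p t y <= V) (y \in nbr p V t x).
Proof. by rewrite inE ler_norml; exact: idP. Qed.

Lemma nbrC t x y : (y \in nbr p V t x) = (x \in nbr p V t y).
Proof. by rewrite !inE distrC. Qed.

Lemma lpos_le t x y : y \in nbr p V t x -> lpos p V t x <= p t y.
Proof. by move=> h; apply: bigmin_le_cond. Qed.

Lemma lpos_le_self t x : lpos p V t x <= p t x.
Proof. exact: bigmin_le_id. Qed.

Lemma le_rpos t x y : y \in nbr p V t x -> p t y <= rpos p V t x.
Proof. by move=> h; apply: le_bigmax_cond. Qed.

Lemma self_le_rpos t x : p t x <= rpos p V t x.
Proof. exact: bigmax_ge_id. Qed.

Lemma lpos_ge t x m : m <= p t x ->
  (forall y, y \in nbr p V t x -> m <= p t y) -> m <= lpos p V t x.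
Proof. by move=> mx my; apply/bigmin_geP; split. Qed.

Lemma rpos_le t x m : p t x <= m ->
  (forall y, y \in nbr p V t x -> p t y <= m) -> rpos p V t x <= m.
Proof. by move=> mx my; apply/bigmax_leP; split. Qed.

Lemma lpos_ge_radius t x : 0 <= V -> p t x - V <= lpos p V t x.
Proof.
move=> V0; apply: lpos_ge => [|y /nbrP]; first by rewrite gerBl.
lra.
Qed.

Lemma rpos_le_radius t x : 0 <= V -> rpos p V t x <= p t x + V.
Proof.
move=> V0; apply: rpos_le => [|y /nbrP]; first by rewrite lerDl.
lra.
Qed.

Lemma eq_nbr t x y : p t x = p t y -> nbr p V t x =i nbr p V t y.
Proof. by move=> e z; rewrite !inE e. Qed.

Lemma eq_lpos t x y : p t x = p t y -> lpos p V t x = lpos p V t y.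
Proof. by move=> e; rewrite /lpos e; apply: eq_bigl => z; rewrite !inE e. Qed.

Lemma eq_rpos t x y : p t x = p t y -> rpos p V t x = rpos p V t y.
Proof. by move=> e; rewrite /rpos e; apply: eq_bigl => z; rewrite !inE e. Qed.

Lemma is_lP t x a : reflect
  [/\ a \in nbr p V t x, lpos p V t x = p t a & represents p t a]
  (is_l p V t x a).
Proof.
apply: (iffP and3P) => -[ax e ra]; split=> //; first by rewrite (eqP e).
by rewrite e.
Qed.

Lemma is_rP t x b : reflect
  [/\ b \in nbr p V t x, rpos p V t x = p t b & represents p t b]
  (is_r p V t x b).
Proof.
apply: (iffP and3P) => -[ax e ra]; split=> //; first by rewrite (eqP e).
by rewrite e.
Qed.

Lemma representsP t a : reflect
  (faulty a \/ forall f, faulty f -> p t f <> p t a) (represents p t a).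
Proof.
apply: (iffP orP) => -[fa|h]; [by left|right|by left|right].
  by move=> f ff; apply/eqP; exact: (implyP (forallP h f) ff).
by apply/forallP => f; apply/implyP => ff; apply/eqP; exact: h.
Qed.

End Neighbours.

(** * What one synchronous step preserves: order, visibility and extreme neighbours *)

Section Stable.
Context (R : realType) (n : nat) (p : nat -> 'I_n.+1 -> R) (V : R).
Context (hsys : robot_system p V) (hstable : size_stable p V 0).
Implicit Types (s t : nat) (x y a b : 'I_n.+1).
Local Notation x_first := (@x_first n).
Local Notation x_last := (@x_last n).

Lemma radius_ge0 : 0 <= V.
Proof. by case: hsys => /ltW. Qed.

Lemma faultyP x : reflect (x = x_first \/ x = x_last) (faulty x).
Proof. by apply: (iffP orP) => -[]/eqP; [left|right|left|right]. Qed.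

Lemma faulty_step s x : faulty x -> p s.+1 x = p s x.
Proof.
case: hsys => _ h0 [d _ hd] _ /faultyP[]->; first by rewrite !h0.
by rewrite !hd.
Qed.

Lemma x_last_const s t : p s x_last = p t x_last.
Proof. by case: hsys => _ _ [d _ hd] _; rewrite !hd. Qed.

Lemma x_first_lt_last s : p s x_first < p s x_last.
Proof. by case: hsys => _ h0 [d d0 hd] _; rewrite h0 hd. Qed.

Lemma nonfaulty_step s x : ~~ faulty x ->
  p s.+1 x = (lpos p V s x + rpos p V s x) / 2.
Proof. by case: hsys => _ _ _; exact. Qed.

Lemma lt_step s x y : p s x < p s y -> p s.+1 x < p s.+1 y.
Proof.
move=> xy; have [/(_ x y)[_ merg cross] _] := hstable (leq0n s).
rewrite lt_neqAle leNgt; apply/andP; split; apply/negP => h.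
  by apply: merg; split; [move=> e; rewrite e ltxx in xy|exact/eqP].
exact: cross.
Qed.

Lemma eq_step s x y : ~~ faulty x -> ~~ faulty y ->
  p s x = p s y -> p s.+1 x = p s.+1 y.
Proof.
by move=> fx fy e; rewrite !nonfaulty_step// (eq_lpos V e) (eq_rpos V e).
Qed.

(* A robot standing on x_first cannot step to its left: whatever pulls it there
   is an outsider, and it would have to merge with that outsider. *)
Lemma ge_first_step s x :
  p s x_first <= p s x -> p s.+1 x_first <= p s.+1 x.
Proof.
rewrite le_eqVlt => /predU1P[e|/lt_step/ltW//].
have [fx|nfx] := boolP (faulty x); first by rewrite !faulty_step// e.
rewrite leNgt; apply/negP => out.
have [y out_y] : exists y, p s y < p s x_first.
  apply/not_existsP => h; move: out; rewrite (nonfaulty_step s nfx) faulty_step//.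
    have := self_le_rpos p V s x.
    have : p s x_first <= lpos p V s x.
      by apply: lpos_ge => [|y _]; [rewrite e|rewrite leNgt; apply/negP/h].
    lra.
have [_ [/(_ y)/andP[]|[_ _ stay _ _]]] := hstable (leq0n s).
  by rewrite leNgt out_y.
have /lt_step y_last := lt_trans out_y (x_first_lt_last s).
have y_first : p s.+1 y < p s.+1 x_first.
  rewrite ltNge; apply/negP => ge; apply: (stay y s.+1) => //.
    by case/andP; rewrite leNgt out_y.
  by rewrite /inside ge ltW.
have [_ [/(_ x)/andP[]|[lone _ _ _ _]]] := hstable (leq0n s.+1).
  by rewrite leNgt out.
have [/(_ x y)[_ merg _] _] := hstable (leq0n s).
by apply: merg; split; [move=> exy; lra|exact: lone].
Qed.

(** Mirror image of [ge_first_step]. *)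
Lemma le_last_step s x : p s x <= p s x_last -> p s.+1 x <= p s.+1 x_last.
Proof.
rewrite le_eqVlt => /predU1P[e|/lt_step/ltW//].
have [fx|nfx] := boolP (faulty x).
  by rewrite faulty_step// e (x_last_const s.+1 s).
rewrite leNgt; apply/negP => out.
have [y out_y] : exists y, p s x_last < p s y.
  apply/not_existsP => h; move: out.
    rewrite (nonfaulty_step s nfx) (x_last_const s.+1 s).
    have := lpos_le_self p V s x.
    have : rpos p V s x <= p s x_last.
      by apply: rpos_le => [|y _]; [rewrite e|rewrite leNgt; apply/negP/h].
    lra.
have [_ [/(_ y)/andP[]|[_ _ stay _ _]]] := hstable (leq0n s).
  by rewrite (leNgt (p s y)) out_y.
have /lt_step y_first := lt_trans (x_first_lt_last s) out_y.
have y_last : p s.+1 x_last < p s.+1 y.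
  rewrite ltNge; apply/negP => le; apply: (stay y s.+1) => //.
    by case/andP; rewrite (leNgt (p s y)) out_y.
  by rewrite /inside le ltW.
have [_ [/(_ x)/andP[]|[_ lone _ _ _]]] := hstable (leq0n s.+1).
  by rewrite (leNgt (p s.+1 x)) out.
have [/(_ x y)[_ merg _] _] := hstable (leq0n s).
by apply: merg; split; [move=> exy; lra|exact: lone].
Qed.

(** A gain of visibility is an inclusion. None is lost: between non-faulty robots, [r(x) >= y],
    [l(x) >= x - V], [l(y) <= x] and [r(y) <= y + V] bound the difference of the midpoints by [V],
    and symmetrically; a motionless robot only makes this easier. *)
Lemma nbr_step s x y : (y \in nbr p V s.+1 x) = (y \in nbr p V s x).
Proof.
apply/idP/idP => xy.
  rewrite inE leNgt; apply/negP => far.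
  have [/(_ x y)[incl _ _] _] := hstable (leq0n s).
  by apply: incl; split=> //; rewrite inE in xy.
have /nbrP dxy := xy; have yx := xy; rewrite nbrC in yx; apply/nbrP.
have := (radius_ge0, lpos_ge_radius p s x radius_ge0,
  rpos_le_radius p s x radius_ge0, lpos_le xy, lpos_le_self p V s x, le_rpos xy,
  self_le_rpos p V s x, lpos_ge_radius p s y radius_ge0,
  rpos_le_radius p s y radius_ge0, lpos_le yx, lpos_le_self p V s y).
have := (le_rpos yx, self_le_rpos p V s y).
move=> [? ?] [[[[[[[[[[? ?] ?] ?] ?] ?] ?] ?] ?] ?] ?].
have [fx|nfx] := boolP (faulty x); have [fy|nfy] := boolP (faulty y).
- by rewrite !faulty_step.
- by rewrite faulty_step// nonfaulty_step//; lra.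
- by rewrite nonfaulty_step// faulty_step//; lra.
- by rewrite !nonfaulty_step//; lra.
Qed.

Lemma represents_step s a : represents p s a -> represents p s.+1 a.
Proof.
case/representsP => [fa|ra]; apply/representsP; [by left|right] => f ff.
have [/lt_step h e|/lt_step h e|/(ra _ ff)//] := ltgtP (p s f) (p s a).
  by rewrite e ltxx in h.
by rewrite e ltxx in h.
Qed.

(** Strict order persists, so only the robots sharing the position of [a] matter. Those on [x_first]
    can leave only to the right; if [a] is non-faulty, [represents] makes them all non-faulty, and
    they move together. From [x_last] they may step to the left, hence the exclusion. *)
Lemma is_l_step s x a : is_l p V s x a -> a != x_last -> is_l p V s.+1 x a.
Proof.
move=> /is_lP[ax e ra] nlast; have ax' : a \in nbr p V s.+1 x by rewrite nbr_step.
apply/is_lP; split=> //; last exact: represents_step.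
apply/eqP; rewrite eq_le lpos_le//=.
suff le_a z : z \in nbr p V s x -> p s.+1 a <= p s.+1 z.
  apply: lpos_ge => [|z]; last by rewrite nbr_step; exact: le_a.
  (* The default value of [lpos] is the position of [x], which sees itself as [0 <= V]. *)
  by apply: le_a; apply/nbrP; have := radius_ge0; lra.
move=> zx; have := lpos_le zx; rewrite e le_eqVlt => /predU1P[az|/lt_step/ltW//].
case/representsP: ra => [/faultyP[a_first|a_last]|ra].
- by rewrite a_first ge_first_step// -a_first az.
- by rewrite a_last eqxx in nlast.
- have [fz|nfz] := boolP (faulty z); first by case: (ra _ fz).
  by rewrite (eq_step _ nfz az)//; apply/negP => /ra.
Qed.

Lemma is_r_step s x b : is_r p V s x b -> b != x_first -> is_r p V s.+1 x b.
Proof.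
move=> /is_rP[bx e rb] nfirst; have bx' : b \in nbr p V s.+1 x by rewrite nbr_step.
apply/is_rP; split=> //; last exact: represents_step.
apply/eqP; rewrite eq_le le_rpos// andbT.
suff le_b z : z \in nbr p V s x -> p s.+1 z <= p s.+1 b.
  apply: rpos_le => [|z]; last by rewrite nbr_step; exact: le_b.
  by apply: le_b; apply/nbrP; have := radius_ge0; lra.
move=> zx; have := le_rpos zx; rewrite e le_eqVlt => /predU1P[zb|/lt_step/ltW//].
case/representsP: rb => [/faultyP[b_first|b_last]|rb].
- by rewrite b_first eqxx in nfirst.
- by rewrite b_last le_last_step// -b_last zb.
- have [fz|nfz] := boolP (faulty z); first by case: (rb _ fz).
  by rewrite (eq_step nfz _ zb)//; apply/negP => /rb.
Qed.

Lemma is_l_persists t s x a : is_l p V t x a -> a != x_last -> (t <= s)%N ->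
  is_l p V s x a.
Proof.
move=> la na /subnK <-; elim: (s - t)%N => // m IH.
by rewrite addSn; exact: is_l_step.
Qed.

Lemma is_r_persists t s x b : is_r p V t x b -> b != x_first -> (t <= s)%N ->
  is_r p V s x b.
Proof.
move=> rb nb /subnK <-; elim: (s - t)%N => // m IH.
by rewrite addSn; exact: is_r_step.
Qed.

(** * Geometry of chains and their anchors at a fixed time *)

Section Chains.
Context (t : nat).
Implicit Types (c z : seq 'I_n.+1).

(* Unlike [anchored], this also holds of the primary chain, whose extremities
   are its anchors. *)
Definition flanked z a b : Prop :=
  if z is x :: z' then
    (x = a \/ is_l p V t x a) /\ (last x z' = b \/ is_r p V t (last x z') b)
  else False.

Lemma anchored_flanked z a b : anchored p V t z a b -> flanked z a b.
Proof. by case: z => //= x z /andP[]; split; right. Qed.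

(** Since [r(x)] is never left of [x], the links increase weakly; distinct positions make them
    strict. *)
Lemma mutual_chain_lt x z x0 : mutual_chain p V t (x :: z) -> x0 \in z ->
  p t x < p t x0.
Proof.
case/andP => uz sz; have : sorted <%R [seq p t u | u <- x :: z].
  rewrite lt_sorted_uniq_le uz sorted_map; apply: sub_sorted sz => u v.
  by case/andP => _ /is_rP[_ e _]; rewrite /= -e; exact: self_le_rpos.
rewrite /= path_sortedE; last exact: lt_trans.
by case/andP => /allP h _ zx0; apply: h; exact: map_f.
Qed.

Lemma mutual_chain_rcons_lt x z x0 : mutual_chain p V t (rcons z x) ->
  x0 \in z -> p t x0 < p t x.
Proof.
move=> mz zx0; move: mz; case/splitPr: zx0 => z1 z2.
rewrite rcons_cat => /andP[]; rewrite map_cat cat_uniq => /and3P[_ _ uz].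
move=> /cat_sorted2[_ sz].
by apply: (@mutual_chain_lt _ (rcons z2 x)); [apply/andP|rewrite mem_rcons mem_head].
Qed.

Lemma mutual_chain_between x z x0 : mutual_chain p V t (x :: z) ->
  x0 \in x :: z -> p t x <= p t x0 <= p t (last x z).
Proof.
move=> mz zx0; apply/andP; split.
  by move: zx0; rewrite in_cons => /predU1P[->|/(mutual_chain_lt mz)/ltW].
move: mz zx0; rewrite lastI => mz.
by rewrite mem_rcons in_cons => /predU1P[->|/(mutual_chain_rcons_lt mz)/ltW].
Qed.

Lemma mutual_chain_behead x z : mutual_chain p V t (x :: z) ->
  mutual_chain p V t z.
Proof. by case/andP => /=/andP[_ uz] /path_sorted sz; apply/andP. Qed.

Lemma mutual_chain_belast x z : mutual_chain p V t (rcons z x) ->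
  mutual_chain p V t z.
Proof.
rewrite -cats1 => /andP[]; rewrite map_cat cat_uniq => /andP[uz _].
by move=> /cat_sorted2[sz _]; apply/andP.
Qed.

Lemma flanked_between z a b x : mutual_chain p V t z -> flanked z a b ->
  x \in z -> p t a <= p t x <= p t b.
Proof.
case: z => // u z mz [ua ub] /(mutual_chain_between mz)/andP[ux xu].
apply/andP; split.
  apply: le_trans ux; case: ua => [->//|/is_lP[_ <- _]]; exact: lpos_le_self.
by apply: le_trans xu _; case: ub => [->//|/is_rP[_ <- _]]; exact: self_le_rpos.
Qed.

(** By strict monotonicity only the first robot can be [a]. If it is dropped, mutuality makes [a]
    the left extreme of its successor, so the shortened chain is properly anchored on the left. *)
Lemma filter_anchor_l z a b : mutual_chain p V t z -> flanked z a b ->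
  let z' := [seq x <- z | x != a] in z' != [::] ->
  [/\ mutual_chain p V t z', flanked z' a b & is_l p V t (head a z') a].
Proof.
case: z => // x z mz flz /=.
have /all_filterP -> : all (fun u => u != a) z.
  apply/allP => u /(mutual_chain_lt mz) xu; apply/eqP => ua.
  have /andP[] := flanked_between mz flz (mem_head x z).
  by rewrite -ua leNgt xu.
case: flz => xa xb; case: (eqVneq x a) => [ea|na] /=; last first.
  move=> _; case: xa => [xa|xa]; first by rewrite xa eqxx in na.
  by split=> //; split=> //; right.
case: z mz xb => // u z mz /= xb _; subst x.
have ua : is_l p V t u a by case/andP: mz => _ /=/andP[/andP[]].
by split=> //; [exact: mutual_chain_behead mz|split=> //; right].
Qed.

(** Symmetric for the last robot. The head survives as long as the list is non-empty, so the left
    anchoring already obtained is kept. *)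
Lemma filter_anchor_r z a b : mutual_chain p V t z -> flanked z a b ->
  is_l p V t (head a z) a ->
  let z' := [seq x <- z | x != b] in z' != [::] ->
  mutual_chain p V t z' /\ anchored p V t z' a b.
Proof.
case/lastP: z => // z x mz flz ha /=; rewrite filter_rcons.
have /all_filterP -> : all (fun u => u != b) z.
  apply/allP => u /(mutual_chain_rcons_lt mz) ux; apply/eqP => ub.
  have xz : x \in rcons z x by rewrite mem_rcons mem_head.
  by have /andP[_] := flanked_between mz flz xz; rewrite -ub leNgt ux.
have xb : x = b \/ is_r p V t x b.
  by move: flz; case: (z) => [|u z'] /= []; rewrite ?last_rcons.
case: (eqVneq x b) => [eb|nb] /= nz.
  split; first exact: mutual_chain_belast mz.
  subst x; case/lastP: z mz ha nz {flz xb} => // z u mz ha _.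
  have ub : is_r p V t u b.
    case/andP: mz => _; rewrite -!cats1 -catA => /cat_sorted2[_] /=.
    by rewrite andbT => /andP[].
  by case: z ha {mz} => [|v z] /= ->; rewrite ?last_rcons.
case: xb => [xb|xb]; first by rewrite xb eqxx in nb.
split=> //.
by case: z ha {mz flz nz} => [|v z] /= ->; rewrite ?last_rcons.
Qed.

(** This brings the primary chain, whose ends are its own anchors, to the same form as the
    others. *)
Lemma non_anchors_chain z a b : mutual_chain p V t z -> flanked z a b ->
  non_anchors z a b != [::] ->
  mutual_chain p V t (non_anchors z a b) /\ anchored p V t (non_anchors z a b) a b.
Proof.
move=> mz flz.
have -> : non_anchors z a b = [seq x <- [seq x <- z | x != a] | x != b].
  by rewrite -filter_predI; apply: eq_filter => x /=; rewrite andbC.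
move=> nz; have nz' : [seq x <- z | x != a] != [::] by apply: contra nz => /eqP->.
have [mz' flz' la] := filter_anchor_l mz flz nz'.
exact: filter_anchor_r.
Qed.

(** The witness is the predecessor of [x_last]. Seen from the position of [x_last], it prevents
    [x_last] from being leftmost. *)
Lemma primary_near_last c : primary_chain p V t c ->
  exists2 u, u \in nbr p V t x_last & p t u < p t x_last.
Proof.
case=> mc [z ec]; rewrite ec -rcons_cons in mc; exists (last x_first z).
  case/andP: mc => _ /=; rewrite rcons_path => /andP[_ /andP[/is_lP[]]//].
apply: (mutual_chain_rcons_lt mc); exact: mem_last.
Qed.

Lemma primary_near_first c : primary_chain p V t c ->
  exists2 u, u \in nbr p V t x_first & p t x_first < p t u.
Proof.
case=> mc [z ec]; rewrite ec in mc; exists (head x_last z).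
  by case/andP: mc => _; case: (z) => /= [|u z'] /andP[/andP[_ /is_rP[]]].
by apply: (mutual_chain_lt mc); case: (z) => [|u z']; rewrite /= mem_head.
Qed.

(** Provides the side condition of [is_l_persists]: a robot inside the segment with [x_last] as its
    left extreme would stand on [x_last], hence see a robot strictly to its left. *)
Lemma anchor_l_neq_last c z a b : primary_chain p V t c ->
  {in z, forall x, inside p t x} -> anchored p V t z a b -> a != x_last.
Proof.
case/primary_near_last => u u_last lt_u; case: z => // x z /(_ x (mem_head x z)).
case/andP => _ xd /= /andP[/is_lP[_ ea _] _]; apply/eqP => a_last.
rewrite a_last in ea.
have ex : p t x = p t x_last.
  by apply/eqP; rewrite eq_le xd -ea lpos_le_self.
have /lpos_le : u \in nbr p V t x by rewrite (eq_nbr V ex).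
by rewrite ea leNgt lt_u.
Qed.

Lemma anchor_r_neq_first c z a b : primary_chain p V t c ->
  {in z, forall x, inside p t x} -> anchored p V t z a b -> b != x_first.
Proof.
case/primary_near_first => u u_first lt_u.
case: z => // x z /(_ (last x z) (mem_last x z)).
case/andP => xd _ /= /andP[_ /is_rP[_ eb _]]; apply/eqP => b_first.
rewrite b_first in eb.
have ex : p t (last x z) = p t x_first.
  by apply/eqP; rewrite eq_le xd -eb self_le_rpos.
have /le_rpos : u \in nbr p V t (last x z) by rewrite (eq_nbr V ex).
by rewrite eb leNgt lt_u.
Qed.

Lemma represents_first a : represents p t a -> p t a = p t x_first ->
  a = x_first.
Proof.
move=> /representsP[/faultyP[//|->]|ra] ea.
  by have := x_first_lt_last t; rewrite ea ltxx.
by case: (ra x_first) => //; exact/faultyP/or_introl.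
Qed.

Lemma represents_last b : represents p t b -> p t b = p t x_last ->
  b = x_last.
Proof.
move=> /representsP[/faultyP[->|//]|rb] eb.
  by have := x_first_lt_last t; rewrite eb ltxx.
by case: (rb x_last) => //; exact/faultyP/or_intror.
Qed.

(** A faulty robot of the chain is an end of the segment, so the anchor on that side is squeezed
    onto it; by [represents] that anchor is the faulty robot itself. *)
Lemma anchored_nonfaulty z a b x : mutual_chain p V t z ->
  anchored p V t z a b -> inside p t a -> inside p t b ->
  x \in z -> x != a -> x != b -> ~~ faulty x.
Proof.
move=> mz az ia ib xz xa xb.
have /andP[ax bx] := flanked_between mz (anchored_flanked az) xz.
have [ra rb] : represents p t a /\ represents p t b.
  by case: (z) az => // u z' /andP[/is_lP[_ _ ?] /is_rP[_ _ ?]].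
apply/negP => /faultyP[ex|ex]; rewrite ex in ax bx xa xb.
  case/negP: xa; rewrite (represents_first ra)//.
  by apply/eqP; rewrite eq_le ax; case/andP: ia.
case/negP: xb; rewrite (represents_last rb)//.
by apply/eqP; rewrite eq_le bx andbT; case/andP: ib.
Qed.

(** * Limits along a chain with convergent anchors *)

Lemma chain_limits k (y : nat -> 'I_n.+1) a b (la lb : R) : (0 < k)%N ->
  let z := [seq y i | i <- iota 1 k] in
  mutual_chain p V t z -> anchored p V t z a b ->
  {in z, forall x, ~~ faulty x} -> a != x_last -> b != x_first ->
  p s a @[s --> \oo] --> la -> p s b @[s --> \oo] --> lb ->
  forall i, (i <= k.+1)%N ->
    chain_pos p V k y i @ \oo --> la + (lb - la) / k.+1%:R * i%:R.
Proof.
move=> k0 z mz az nfz na nb cva cvb i ik.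
(* The robots at sites 0 to k+1, with the anchors fixed at time [t] placed at both ends. *)
pose w j := if j == 0%N then a else if j == k.+1 then b else y j.
have nf j : (j < k)%N -> ~~ faulty (y j.+1).
  by move=> jk; apply: nfz; apply: map_f; rewrite mem_iota.
have sz : size z = k by rewrite size_map size_iota.
have nthz j : (j < k)%N -> nth a z j = y j.+1.
  by move=> jk; rewrite (nth_map 0%N) ?size_iota// nth_iota.
have link j : (j.+1 < k)%N ->
    is_l p V t (y j.+2) (y j.+1) /\ is_r p V t (y j.+1) (y j.+2).
  move=> jk; case/andP: mz => _ /(sortedP a)/(_ j); rewrite sz => /(_ jk).
  by rewrite !nthz ?(ltnW jk)// => /andP.
have [l1 rk] : is_l p V t (y 1%N) a /\ is_r p V t (y k) b.
  move: az; rewrite /z; case: (k) k0 => // k' _ /= /andP[-> ].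
  rewrite last_map; have -> // : last 1%N (iota 2 k') = k'.+1.
  by rewrite (last_nth 0%N) size_iota -[_ :: _]/(iota 1 k'.+1) nth_iota.
have lw s j : (j < k)%N -> (t <= s)%N -> is_l p V s (y j.+1) (w j).
  case: j => [_|j jk] ts; first exact: is_l_persists l1 na ts.
  rewrite /w /= eqSS (ltn_eqF (ltnW jk)).
  apply: is_l_persists (link j jk).1 _ ts.
  by apply/eqP => e; case/negP: (nf j (ltnW jk)); exact/faultyP/or_intror.
have rw s j : (j < k)%N -> (t <= s)%N -> is_r p V s (y j.+1) (w j.+2).
  move=> jk ts; rewrite /w /=; case: eqP => [[->]|/eqP nj].
    exact: is_r_persists rk nb ts.
  have jk' : (j.+1 < k)%N by lia.
  apply: is_r_persists (link j jk').2 _ ts.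
  by apply/eqP => e; case/negP: (nf j.+1 jk'); exact/faultyP/or_introl.
(* The extremes [l(y_1)] and [r(y_k)], recomputed at each time [s], remain the anchors found at time
   [t]. *)
have posE s j : (t <= s)%N -> (j <= k.+1)%N -> chain_pos p V k y j s = p s (w j).
  move=> ts jk; rewrite /chain_pos /w; case: eqP => _.
    by have /is_lP[_ -> _] := is_l_persists l1 na ts.
  by case: eqP => // _; have /is_rP[_ -> _] := is_r_persists rk nb ts.
apply: (averaging_cvg (T := t)) => //.
- move=> j s jk ts; rewrite !posE; [|lia..].
  rewrite [w j.+1]/w /= eqSS ltn_eqF// nonfaulty_step//; last exact: nf.
  by have /is_lP[_ -> _] := lw s j jk ts; have /is_rP[_ -> _] := rw s j jk ts.
- apply: cvg_trans cva; apply: near_eq_cvg; exists t => // s ts.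
  by rewrite posE.
- apply: cvg_trans cvb; apply: near_eq_cvg; exists t => // s ts.
  by rewrite posE// /w /= eqxx.
Qed.

Lemma flanked_inside z a b : mutual_chain p V t z -> flanked z a b ->
  inside p t a -> inside p t b -> {in z, forall x, inside p t x}.
Proof.
move=> mz fz /andP[fa _] /andP[_ bl] x xz.
have /andP[ax xb] := flanked_between mz fz xz.
by rewrite /inside (le_trans fa ax) (le_trans xb bl).
Qed.

Lemma flanked_limits c z a b k (y : nat -> 'I_n.+1) (la lb : R) :
  primary_chain p V t c -> mutual_chain p V t z -> flanked z a b ->
  inside p t a -> inside p t b ->
  p s a @[s --> \oo] --> la -> p s b @[s --> \oo] --> lb ->
  (0 < k)%N -> [seq y i | i <- iota 1 k] = non_anchors z a b ->
  forall i, (i <= k.+1)%N ->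
    chain_pos p V k y i @ \oo --> la + (lb - la) / k.+1%:R * i%:R.
Proof.
move=> pc mz fz ia ib cva cvb k0 ey.
have nz : non_anchors z a b != [::] by rewrite -ey -size_eq0 size_map size_iota -lt0n.
have [mz' az'] := non_anchors_chain mz fz nz.
have iz' : {in non_anchors z a b, forall x, inside p t x}.
  by move=> x; rewrite mem_filter => /andP[_]; exact: flanked_inside mz fz ia ib x.
have nfz' : {in non_anchors z a b, forall x, ~~ faulty x}.
  move=> x xz; move: (xz); rewrite mem_filter => /andP[/andP[xa xb] _].
  exact: anchored_nonfaulty mz' az' ia ib xz xa xb.
apply: (@chain_limits k y a b la lb k0); rewrite ?ey//.
  exact: anchor_l_neq_last pc iz' az'.
exact: anchor_r_neq_first pc iz' az'.
Qed.

Lemma flanked_cvg c z a b : primary_chain p V t c ->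
  mutual_chain p V t z -> flanked z a b -> inside p t a -> inside p t b ->
  cvg (p s a @[s --> \oo]) -> cvg (p s b @[s --> \oo]) ->
  {in z, forall x, cvg (p s x @[s --> \oo])}.
Proof.
move=> pc mz fz ia ib cva cvb x xz.
have [->//|xa] := eqVneq x a; have [->//|xb] := eqVneq x b.
have xw : x \in non_anchors z a b by rewrite mem_filter xa xb.
(* Sites are numbered from 1 and list entries from 0, so [x] sits at site [(index x w).+1]. *)
pose w := non_anchors z a b; pose y i := nth a w i.-1.
have w0 : (0 < size w)%N.
  by rewrite lt0n size_eq0; apply/eqP => e; rewrite -/w e in xw.
have ey : [seq y i | i <- iota 1 (size w)] = w.
  by rewrite (iotaDl 1 0) -map_comp -[RHS](mkseq_nth a).
have ix : (index x w < size w)%N by rewrite index_mem.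
have := flanked_limits pc mz fz ia ib cva cvb w0 ey (leqW ix).
rewrite /chain_pos /= eqSS ltn_eqF// /y /= nth_index// => cvx.
by apply/cvg_ex; eexists; exact: cvx.
Qed.

(** * Induction on the level *)

Lemma faulty_cvg x : faulty x -> cvg (p s x @[s --> \oo]).
Proof.
move=> fx; apply/cvg_ex; exists (p 0%N x).
rewrite (_ : (fun s => p s x) = fun=> p 0%N x); first exact: cvg_cst.
by apply/funext; elim=> // s <-; rewrite faulty_step.
Qed.

Lemma primary_flanked c : primary_chain p V t c ->
  flanked c x_first x_last.
Proof. by case=> _ [z ->] /=; rewrite last_rcons; split; left. Qed.

Lemma first_inside : inside p t x_first.
Proof. by rewrite /inside lexx ltW// x_first_lt_last. Qed.

Lemma last_inside : inside p t x_last.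
Proof. by rewrite /inside lexx ltW// x_first_lt_last. Qed.

(** Anchors are faulty or taken from chains of lower level, so the induction must carry, for every
    robot of a chain, both its convergence and its being inside the segment. A primary chain is
    available at the root of every derivation. *)
Lemma level_chain_flanked j z a b : level_chain p V t j z a b ->
  (exists c, primary_chain p V t c) /\
  [/\ mutual_chain p V t z, flanked z a b,
      {in a :: b :: z, forall x, inside p t x} &
      {in a :: b :: z, forall x, cvg (p s x @[s --> \oo])}].
Proof.
have f_first : faulty x_first by exact/faultyP/or_introl.
have f_last : faulty x_last by exact/faultyP/or_intror.
pose good x := inside p t x /\ cvg (p s x @[s --> \oo]).
have good_chain c z' a' b' : primary_chain p V t c -> mutual_chain p V t z' ->
    flanked z' a' b' -> good a' -> good b' -> {in a' :: b' :: z', forall x, good x}.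
  move=> pc mz fz ga gb x; rewrite !in_cons => /or3P[/eqP->//|/eqP->//|xz].
  case: ga gb => ia ca [ib cb]; split; first exact: flanked_inside mz fz ia ib x xz.
  exact: flanked_cvg pc mz fz ia ib ca cb x xz.
have good_primary c : primary_chain p V t c -> {in c, forall x, good x}.
  move=> pc x xc; have [mc _] := pc.
  apply: (good_chain _ _ _ _ pc mc (primary_flanked pc)).
  - by split; [exact: first_inside|exact: faulty_cvg].
  - by split; [exact: last_inside|exact: faulty_cvg].
  - by rewrite !in_cons xc !orbT.
suff main : level_chain p V t j z a b -> (exists c, primary_chain p V t c) /\
    [/\ mutual_chain p V t z, flanked z a b &
        {in a :: b :: z, forall x, good x}].
  move=> /main[pc [mz fz gz]]; split=> //; split=> // x /gz; by case.
elim=> {j z a b} [c pc|c z a b pc ac bc _ mz az|j j' c a1 b1 c' a2 b2 z a b _ _ _].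
- split; first by exists c.
  have [mc _] := pc; split=> //; first exact: primary_flanked.
  apply: (good_chain _ _ _ _ pc mc (primary_flanked pc)).
    by split; [exact: first_inside|exact: faulty_cvg].
  by split; [exact: last_inside|exact: faulty_cvg].
- split; first by exists c.
  split=> //; first exact: anchored_flanked.
  by apply: (good_chain _ _ _ _ pc mz (anchored_flanked az));
    exact: (good_primary _ pc).
- move=> [[c0 pc] [_ _ gc]] _ [_ [_ _ gc']] ab mz az.
  split; first by exists c0.
  split=> //; first exact: anchored_flanked.
  have {}gc x : x \in c -> good x.
    by move=> xc; apply: gc; rewrite !in_cons xc !orbT.
  have {}gc' x : x \in c' -> good x.
    by move=> xc; apply: gc'; rewrite !in_cons xc !orbT.
  by case/orP: ab => /andP[ac bc];
    apply: (good_chain _ _ _ _ pc mz (anchored_flanked az)); auto.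
Qed.

End Chains.
End Stable.

Theorem theorem16 (R : realType) (n : nat) (V : R) (p : nat -> 'I_n.+1 -> R)
  (hsys : robot_system p V)
  (hstable : size_stable p V 0)
  (j : nat) (hj : (1 <= j)%N)
  (t : nat) (ht : size_stable p V t)
  (C : seq 'I_n.+1) (a b : 'I_n.+1) (hC : level_chain p V t j C a b)
  (k : nat) (hk : (0 < k)%N) (y : nat -> 'I_n.+1)
  (hy : [seq y i | i <- iota 1 k] = non_anchors C a b) :
  exists y0' yk1' : R,
    [/\ chain_pos p V k y 0 @ \oo --> y0',
        chain_pos p V k y k.+1 @ \oo --> yk1'
      & forall i : nat, (i <= k.+1)%N ->
          chain_pos p V k y i @ \oo -->
            y0' + `|yk1' - y0'| / k.+1%:R * i%:R].
Proof.
have [[c pc] [mC fC iC cvC]] := level_chain_flanked hsys hstable hC.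
have a_in : a \in [:: a, b & C] by rewrite mem_head.
have b_in : b \in [:: a, b & C] by rewrite !in_cons eqxx orbT.
have /cvg_ex[la cva] := cvC a a_in; have /cvg_ex[lb cvb] := cvC b b_in.
have lim := flanked_limits hsys hstable pc mC fC (iC a a_in) (iC b b_in)
  cva cvb hk hy.
have lim0 := lim 0%N isT; have limk := lim k.+1 (leqnn _).
rewrite mulr0 addr0 in lim0; rewrite divfK ?pnatr_eq0// addrC subrK in limk.
(* The limits of y_0 and y_1 are ordered because l(y_1) <= y_1. *)
have la_le_lb : la <= lb.
  have le01 : \forall s \near \oo, chain_pos p V k y 0 s <= chain_pos p V k y 1 s.
    apply: nearW => s; rewrite /chain_pos /= eqSS (ltn_eqF hk).
    exact: lpos_le_self.
  have : la <= la + (lb - la) / k.+1%:R * 1%:R.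
    by apply: ler_cvg_to lim0 (lim 1%N isT) le01.
  by rewrite mulr1 lerDl pmulr_lge0 ?invr_gt0// subr_ge0.
(* The order of the limits turns the absolute value into the plain difference. *)
by exists la, lb; split=> // i ik; rewrite ger0_norm ?subr_ge0//; exact: lim.
Qed.
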